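(* Let $n, m$ be integers with $n\geq 3$ and $m\geq 2$. Then the minimum cardinality of a doubly resolving set of the jellyfish graph $JFG(n,m)$ is $nm$.
   Context: For integers $n\ge 3$, $m\ge 1$, the jellyfish graph $JFG(n,m)$ is the simple undirected graph of order $nm+n$ with vertex set $\{1,\dots,n\}\cup\{v_{ij} : 1\le i\le n,\ 1\le j\le m\}$ in which: the vertices $1,\dots,n$ induce the cycle $C_n$ (with edges $\{i,i+1\}$ for $1\le i\le n-1$ and $\{n,1\}$); each vertex $v_{ij}$ has degree $1$ and is adjacent exactly to $i$; there are no other edges. For a finite connected graph $\Gamma$ of order at least $2$ with graph distance $d$, vertices $x,y$ doubly resolve vertices $u,v$ if $d(u,x)-d(u,y)\neq d(v,x)-d(v,y)$. A set $Z$ of vertices is a doubly resolving set of $\Gamma$ if every two distinct vertices of $\Gamma$ are doubly resolved by some two vertices of $Z$. The minimum cardinality of a doubly resolving set is denoted $\psi(\Gamma)$. *)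

(* Defs.v *)
From mathcomp Require Import all_boot all_algebra.

Set Implicit Arguments.
Unset Strict Implicit.
Unset Printing Implicit Defensive.

Section DoublyResolving.

Variables (T : finType) (e : rel T).

Definition walkb (x y : T) (k : nat) : bool :=
  [exists p : k.-tuple T, path e x p && (last x p == y)].

(* Searching lengths below #|T| suffices, since a shortest walk repeats no
   vertex (see gdist_min and gdist_walk); the junk value for disconnected
   vertices is #|T|. *)
Definition gdist (x y : T) : nat := find (walkb x y) (iota 0 #|T|).

(* The differences are signed, hence the cast to int. *)
Definition doubly_resolve (x y u v : T) : bool :=
  ((gdist u x)%:Z - (gdist u y)%:Z != (gdist v x)%:Z - (gdist v y)%:Z)%R.

(* x != y need not be required: for x = y both differences are 0. *)
Definition doubly_resolving (Z : {set T}) : bool :=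
  [forall u, forall v, (u != v) ==>
    [exists x in Z, exists y in Z, doubly_resolve x y u v]].

(* In a connected graph setT is doubly resolving (doubly_resolving_setT), so
   that this is a genuine minimum. *)
Definition psi : nat := #|[arg min_(Z < setT | doubly_resolving Z) #|Z| ]|.

Lemma walkP x y k :
  reflect (exists p, [/\ path e x p, last x p = y & size p = k]) (walkb x y k).
Proof.
apply: (iffP existsP) => [[p /andP[ep /eqP lp]]|[p [ep lp sp]]].
  by exists p; rewrite size_tuple.
by move/eqP: sp => sp; exists (Tuple sp); rewrite /= ep lp eqxx.
Qed.

Lemma gdist_min x p : path e x p -> gdist x (last x p) <= size p.
Proof.
move=> ep; rewrite leqNgt; apply/negP => lt_p.
have lt_pT : size p < #|T|.
  by apply: leq_trans lt_p _; rewrite -[X in _ <= X](size_iota 0) find_size.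
have := before_find 0 lt_p; rewrite nth_iota // add0n.
by case: walkP => // -[]; exists p.
Qed.

Lemma gdist_walk x y : connect e x y ->
  exists p, [/\ path e x p, last x p = y & size p = gdist x y].
Proof.
case/connectP => p /shortenP[q eq uq _] def_y; apply/walkP.
have lt_q : size q < #|T|.
  by rewrite -[_.+1]/(size (x :: q)) -(card_uniqP uq) max_card.
have hasw : has (walkb x y) (iota 0 #|T|).
  apply/hasP; exists (size q); first by rewrite mem_iota.
  by apply/walkP; exists q.
have lt_d := hasw; rewrite has_find size_iota in lt_d.
by have := nth_find 0 hasw; rewrite nth_iota.
Qed.

Lemma gdistxx x : gdist x x = 0.
Proof. by apply/eqP; rewrite -leqn0 (@gdist_min x [::]). Qed.

Lemma gdist_gt0 x y : connect e x y -> x != y -> 0 < gdist x y.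
Proof.
case/gdist_walk => p [_ lp <-]; rewrite -lp.
by case: p {lp} => //=; rewrite eqxx.
Qed.

Lemma doubly_resolving_setT :
  (forall x y, connect e x y) -> doubly_resolving setT.
Proof.
move=> conn; apply/'forall_forallP => u v; apply/implyP => nuv.
apply/exists_inP; exists u => //; apply/exists_inP; exists v => //.
rewrite /doubly_resolve !gdistxx.
have := gdist_gt0 (conn u v) nuv.
by case: (gdist u v) => // k _; rewrite GRing.sub0r GRing.subr0.
Qed.

Lemma psi_min : (forall x y, connect e x y) ->
  (exists2 Z, doubly_resolving Z & #|Z| = psi) /\
  (forall Z, doubly_resolving Z -> psi <= #|Z|).
Proof.
move=> /doubly_resolving_setT drT; rewrite /psi.
by case: arg_minnP => // Z drZ minZ; split; [exists Z | apply: minZ].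
Qed.

End DoublyResolving.

(* ordS is the cyclic successor on 'I_n; vertices are numbered from 0. *)
Definition cycle_graph (n : nat) : rel 'I_n :=
  fun i j => (j == ordS i) || (i == ordS j).

(* inl i is the i-th vertex of the cycle, inr (i, j) the pendant v_ij. *)
Definition jellyfish (n m : nat) : rel ('I_n + 'I_n * 'I_m)%type :=
  fun u v =>
    match u, v with
    | inl i, inl k => cycle_graph i k
    | inl i, inr (k, _) => i == k
    | inr (i, _), inl k => i == k
    | inr _, inr _ => false
    end.

Lemma jellyfish_sym n m : symmetric (@jellyfish n m).
Proof.
by case=> [i|[i j]] [k|[k l]] //=; rewrite /cycle_graph 1?orbC 1?eq_sym.
Qed.

Lemma jellyfish_irrefl n m : 2 <= n -> irreflexive (@jellyfish n m).
Proof.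
move=> n_gt1 [i|[i j]] //=; rewrite /cycle_graph orbb.
apply/eqP => /(congr1 val) /=; have := ltn_ord i.
rewrite leq_eqVlt => /predU1P[def_n|lt_i]; last first.
  by rewrite modn_small // => /n_Sn.
by rewrite def_n modnn => i0; rewrite -def_n i0 in n_gt1.
Qed.

Lemma jellyfish_connected n m u v : connect (@jellyfish n m) u v.
Proof.
have csym := sym_connect_sym (@jellyfish_sym n m).
have toC i j : connect (@jellyfish n m) (inr (i, j)) (inl i).
  by apply: connect1; rewrite /= eqxx.
have fromO (i k : 'I_n) : i <= k -> connect (@jellyfish n m) (inl i) (inl k).
  case: k => k; elim: k => [|k IHk] lt_k /=.
    by rewrite leqn0 => /eqP i0; apply: eq_connect0; congr inl; apply: val_inj.
  rewrite leq_eqVlt => /predU1P[def_i|lt_i].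
    by apply: eq_connect0; congr inl; apply: val_inj.
  apply: connect_trans (IHk (ltnW lt_k) lt_i) _; apply: connect1.
  rewrite /= /cycle_graph; apply/orP; left; apply/eqP/val_inj => /=.
  by rewrite modn_small.
have cyc i k : connect (@jellyfish n m) (inl i) (inl k).
  by case/orP: (leq_total i k) => /fromO; rewrite // csym.
have toc w : exists i, connect (@jellyfish n m) w (inl i).
  by case: w => [i|[i j]]; exists i.
have [i ui] := toc u; have [k vk] := toc v.
by apply: connect_trans ui _; apply: connect_trans (cyc i k) _; rewrite csym.
Qed.

Lemma card_jellyfish n m : #|{: 'I_n + 'I_n * 'I_m}| = n * m + n.
Proof. by rewrite card_sum card_prod !card_ord addnC. Qed.

(* Main.v *)
Require Import Defs.
From mathcomp Require Import all_boot.
From mathcomp Require Import zify.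

Set Implicit Arguments.
Unset Strict Implicit.
Unset Printing Implicit Defensive.

(** A pendant vertex [p] with neighbour [q] satisfies [d(p, x) = d(q, x) + 1]
    for all [x != p], so only a pair containing [p] can doubly resolve [p] and
    [q]: a doubly resolving set contains all [n * m] pendant vertices.
    Conversely, the set of pendant vertices is doubly resolving: a pendant vertex
    and a sibling of it (this is where [2 <= m] enters) have difference of
    distances [-2] at the former, [2] at the latter and [0] at every other
    vertex, while distinct cycle vertices [i] and [k] are doubly resolved by a
    pendant at [i] and a pendant at [k]. *)

Lemma gdist_sym (T : finType) (e : rel T) (x y : T) :
  symmetric e -> (forall u v, connect e u v) -> gdist e x y = gdist e y x.
Proof.
move=> sym_e conn; suff le_d u v : gdist e u v <= gdist e v u.
  by apply/eqP; rewrite eqn_leq !le_d.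
have [p [ep <- <-]] := gdist_walk (conn v u).
(* A shortest walk read backwards is a walk of the same length. *)
have: path e (last v p) (rev (belast v p)).
  by rewrite rev_path (eq_path (e' := e)).
move/gdist_min; rewrite size_rev size_belast.
by case: p {ep} => [|z p] //=; rewrite rev_cons last_rcons.
Qed.

(** Every walk from [p] to another vertex starts with the edge to [q]; conversely, that edge can be
    put in front of any walk from [q]. *)
Lemma gdist_leaf (T : finType) (e : rel T) (p q x : T) :
  (forall u v, connect e u v) -> (forall z, e p z = (z == q)) ->
  x != p -> gdist e p x = (gdist e q x).+1.
Proof.
move=> conn leaf_p nxp; apply/eqP; rewrite eqn_leq; apply/andP; split.
  have [s [es <- <-]] := gdist_walk (conn q x).
  by apply: (@gdist_min _ e p (q :: s)); rewrite /= leaf_p eqxx.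
have [[|z s] /= [es ls <-]] := gdist_walk (conn p x).
  by rewrite ls eqxx in nxp.
by move: es; rewrite leaf_p -ls => /andP[/eqP-> /gdist_min].
Qed.

(** Moving the subtracted terms across leaves a comparison of sums in [nat], without casts. *)
Lemma doubly_resolveE (T : finType) (e : rel T) (x y u v : T) :
  doubly_resolve e x y u v =
    (gdist e u x + gdist e v y != gdist e v x + gdist e u y).
Proof. by rewrite /doubly_resolve; congr (~~ _); apply/eqP/eqP; lia. Qed.

Lemma doubly_resolve_sym (T : finType) (e : rel T) (x y u v : T) :
  doubly_resolve e x y u v = doubly_resolve e x y v u.
Proof. by rewrite /doubly_resolve eq_sym. Qed.

Lemma leaf_in_doubly_resolving (T : finType) (e : rel T) (p q : T)
    (Z : {set T}) :
  (forall u v, connect e u v) -> (forall z, e p z = (z == q)) -> p != q ->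
  doubly_resolving e Z -> p \in Z.
Proof.
move=> conn leaf_p npq /'forall_forallP/(_ p q); rewrite npq /=.
case/exists_inP => x Zx /exists_inP[y Zy]; rewrite doubly_resolveE.
apply: contraTT => nZp.
have nxp : x != p by apply: contraNneq nZp => <-.
have nyp : y != p by apply: contraNneq nZp => <-.
(* Both sums become [gdist e q x + gdist e q y + 1]. *)
by rewrite !(gdist_leaf conn leaf_p) // negbK; lia.
Qed.

Lemma jellyfish_pendant n m (i : 'I_n) (j : 'I_m) z :
  jellyfish (inr (i, j)) z = (z == inl i).
Proof. by case: z => [k|[k l]] //=; rewrite eq_sym. Qed.

Lemma gdist_pendant n m (i : 'I_n) (j : 'I_m) v : v != inr (i, j) ->
  gdist (@jellyfish n m) v (inr (i, j)) = (gdist (@jellyfish n m) v (inl i)).+1.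
Proof.
have sym := @jellyfish_sym n m; have conn := @jellyfish_connected n m.
move=> nv; rewrite (gdist_sym v) // (gdist_sym v (inl i)) //.
exact: (gdist_leaf conn (@jellyfish_pendant n m i j) nv).
Qed.

Lemma doubly_resolve_siblings n m (i : 'I_n) (j j' : 'I_m) v :
  j != j' -> inr (i, j) != v ->
  doubly_resolve (@jellyfish n m) (inr (i, j)) (inr (i, j')) (inr (i, j)) v.
Proof.
move=> njj' nv; rewrite doubly_resolveE gdistxx.
have nx : inr (i, j) != inr (i, j') :> 'I_n + 'I_n * 'I_m.
  by apply: contraNneq njj' => -[->].
rewrite (@gdist_pendant n m i j v) 1?eq_sym // (@gdist_pendant n m i j') //.
(* The sibling is split off because [gdist_pendant] does not apply to its distance 0 from itself. *)
have [->|nv'] := eqVneq v (inr (i, j')); first by rewrite gdistxx; lia.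
by rewrite gdist_pendant //; have := gdist_gt0 (@jellyfish_connected n m
  (inr (i, j)) (inl i)) isT; lia.
Qed.

(** The differences are [-d] at [i] and [d] at [k], where [d > 0] is the distance between [i] and
    [k]. *)
Lemma doubly_resolve_cycle n m (i k : 'I_n) (j : 'I_m) : i != k ->
  doubly_resolve (@jellyfish n m) (inr (i, j)) (inr (k, j)) (inl i) (inl k).
Proof.
move=> nik; rewrite doubly_resolveE !gdist_pendant // !gdistxx.
have := gdist_gt0 (@jellyfish_connected n m (inl i) (inl k)) nik.
by lia.
Qed.

Lemma doubly_resolving_pendants n m : 2 <= m ->
  doubly_resolving (@jellyfish n m) (inr @: [set: 'I_n * 'I_m]).
Proof.
move=> m_gt1; pose Z := inr @: [set: 'I_n * 'I_m] : {set 'I_n + 'I_n * 'I_m}.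
have Zin i j : inr (i, j) \in Z by apply: imset_f.
have pendant i j v : inr (i, j) != v -> [exists x in Z, exists y in Z,
    doubly_resolve (@jellyfish n m) x y (inr (i, j)) v].
  move=> nv; have [j' njj'] : exists j' : 'I_m, j != j'.
    have /card_gt0P[j'] : 0 < #|predC1 j| by rewrite cardC1 card_ord; lia.
    by rewrite inE eq_sym; exists j'.
  apply/exists_inP; exists (inr (i, j)) => //.
  apply/exists_inP; exists (inr (i, j')) => //.
  exact: doubly_resolve_siblings.
apply/'forall_forallP => u v; apply/implyP.
case: u => [i|[i j]]; last exact: pendant.
(* If only [v] is a pendant vertex, exchanging [u] and [v] reduces to [pendant]. *)
case: v => [k|[k l] nv]; last first.
  have /exists_inP[x Zx /exists_inP[y Zy dr]] : [exists x in Z, exists y in Z,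
      doubly_resolve (@jellyfish n m) x y (inr (k, l)) (inl i)].
    by apply: pendant; rewrite eq_sym.
  apply/exists_inP; exists x => //; apply/exists_inP; exists y => //.
  by rewrite doubly_resolve_sym.
(* Any common index would serve for the two pendants; this is 0. *)
move=> nik; pose j := Ordinal (ltnW m_gt1).
apply/exists_inP; exists (inr (i, j)) => //.
apply/exists_inP; exists (inr (k, j)) => //.
exact: doubly_resolve_cycle.
Qed.

Theorem theorem3p2 (n m : nat) (hn : 3 <= n) (hm : 2 <= m) :
  psi (@jellyfish n m) = n * m.
Proof.
have conn := @jellyfish_connected n m.
have card_pendants :
    #|inr @: [set: 'I_n * 'I_m] : {set 'I_n + 'I_n * 'I_m}| = n * m.
  by rewrite card_imset ?cardsT ?card_prod ?card_ord // => a b [].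
have [[Z drZ def_psi] minZ] := psi_min conn.
apply/eqP; rewrite eqn_leq -{1}card_pendants minZ ?doubly_resolving_pendants //=.
(* For the lower bound, every pendant vertex lies in the set [Z] that attains the minimum. *)
rewrite -def_psi -card_pendants; apply/subset_leq_card/subsetP => _ /imsetP[[i j] _ ->].
exact: leaf_in_doubly_resolving conn (@jellyfish_pendant n m i j) _ drZ.
Qed.
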